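(* The property of being a Baire space is backwards inheritable. That is, for every topological space $(X,\tau)$, if there exists a dense subset $D\subseteq X$ such that $(D,\tau|_{D})$ is a Baire space, then $(X,\tau)$ is a Baire space.
   Context: A property $\Phi$ for topological subspaces is called backwards inheritable if for all topological spaces $(X,\tau)$: whenever a dense subset $D\subseteq X$ exists such that $(D,\tau|_{D})$ (subspace topology) satisfies $\Phi$, then $(X,\tau)$ satisfies $\Phi$. A topological space is a Baire space if every countable intersection of dense open subsets is dense. *)

(* Defs.v *)
From mathcomp Require Import all_boot.
From mathcomp Require Import all_classical.
From mathcomp Require Import topology borel_hierarchy.

Set Implicit Arguments.
Unset Strict Implicit.
Unset Printing Implicit Defensive.

Local Open Scope classical_set_scope.

(* [Gdelta_dense S] says that [S] is the intersection of a sequence of dense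
   open sets; a sequence may repeat terms, so finite families are covered.
   Spaces are not assumed pointed: the empty space is allowed (and is Baire). *)
Definition baire_space (X : topologicalType) : Prop :=
  forall S : set X, Gdelta_dense S -> dense S.

(* The canonical topology of [set_type D] is the initial topology of the
   inclusion [set_val : D -> X], i.e. the subspace topology; the library's
   [subspace D] is different, being a topology on the whole of [X]. *)
Definition backwards_inheritable (Phi : topologicalType -> Prop) : Prop :=
  forall X : topologicalType,
    (exists D : set X, dense D /\ Phi (set_type D)) -> Phi X.

(* Main.v *)
Require Import Defs.
From mathcomp Require Import all_boot.
From mathcomp Require Import all_classical.
From mathcomp Require Import topology borel_hierarchy.

Local Open Scope classical_set_scope.

(** Dense open sets of [X] leave dense open traces on a dense [D] ([dense_set_type_preimage]), so
    when [D] is Baire the traces have an intersection dense in [D]. A non-empty open [O] of [X]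
    meets [D], hence its trace is non-empty and open in [D] and contains a point of that
    intersection, which lies in [O] and in every [F i]. *)

Lemma open_set_type_preimage {X : topologicalType} (D A : set X) :
  open A -> open (set_val @^-1` A : set (set_type D)).
Proof. by move=> oA; exists A. Qed.

(** Openness of [U] is essential: it makes [A] [&] [U] an open set, which the dense [D] must then
    meet; two dense sets may be disjoint. *)
Lemma dense_set_type_preimage {X : topologicalType} (D U : set X) :
  dense D -> open U -> dense U -> dense (set_val @^-1` U : set (set_type D)).
Proof.
(* Openness in the initial topology supplies an open [A] of [X] whose trace is the given set. *)
move=> dD oU dU _ /[swap] -[A oA <-] [x Ax].
have [y AUy] : A `&` U !=set0 by apply: dU => //; exists (set_val x).
have [z [AUz Dz]] : A `&` U `&` D !=set0.
  by apply: dD; [exists y | exact: openI].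
by exists (exist _ z (mem_set Dz)).
Qed.

Theorem lemma3p7 : backwards_inheritable baire_space.
Proof.
move=> X [D [dD bD]] _ [F odF ->] O O0 oO.
have dG : dense (\bigcap_i (set_val @^-1` F i : set (set_type D))).
  apply: bD; exists (fun i => set_val @^-1` F i) => // i.
  have [oF dF] := odF i; split; first exact: open_set_type_preimage.
  exact: dense_set_type_preimage.
have [x [Ox Dx]] := dD O O0 oO.
have [|z [Oz Fz]] := dG _ _ (open_set_type_preimage D O oO).
  by exists (exist _ x (mem_set Dx)).
by exists (set_val z).
Qed.
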